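(* Let $(\mathbb{X},\mathbb{T})$ be a tangent category with negatives, $\mathsf{q}=(q:E\to M,+_q,0_q,\lambda)$ a differential bundle, and $K:T(E)\to E$ a vertical connection on $\mathsf{q}$. If $\mathsf{q}$ has a horizontal connection $J:T(M)\times_ME\to T(E)$, then $J(1-\langle K,p\rangle\mu)$ is a horizontal connection on $\mathsf{q}$, and the pair $(K,\;J(1-\langle K,p\rangle\mu))$ is a connection on $\mathsf{q}$ (the difference being formed in the bundle $p_E:T(E)\to E$).
   Context: Conventions: composites are written in diagrammatic order ($fg$ means first $f$, then $g$). $\langle f,g\rangle$ is the induced map into a pullback, $\pi_0,\pi_1$ are projections, $h\times k=\langle\pi_0h,\pi_1k\rangle$ between pullbacks. Component subscripts of natural transformations are often omitted. An additive bundle over $M$ is a map $q:E\to M$ whose finite wide pullbacks $E_n$ along itself exist, with maps $+_q:E_2\to E$, $0_q:M\to E$ making $q$ a commutative monoid in the slice over $M$. An additive bundle morphism $(f_1,f_0)$ from $q:E\to M$ to $q':E'\to M'$ is a pair $f_1:E\to E'$, $f_0:M\to M'$ with $f_1q'=qf_0$ preserving addition and zero. A tangent category is a category with a functor $T$ and natural transformations $p:T\to 1$, $0:1\to T$, $+:T_2\to T$, $\ell:T\to T^2$, $c:T^2\to T^2$ such that: each $(p_M,+_M,0_M)$ is an additive bundle, the wide pullbacks $T_nM$ of $p_M$ exist and are preserved by each $T^k$; $(\ell_M,0_M)$ is an additive bundle morphism from $(p_M,+_M,0_M)$ to $(T(p_M),T(+_M),T(0_M))$; $(c_M,1)$ is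 an additive bundle morphism from $(T(p_M),T(+_M),T(0_M))$ to $(p_{TM},+_{TM},0_{TM})$; $c^2=1$, $\ell c=\ell$, $\ell_M\ell_{TM}=\ell_MT(\ell_M)$, $T(c)cT(c)=cT(c)c$, $\ell_{TM}T(c_M)c_{TM}=c_MT(\ell_M)$; and the square with top $\langle\pi_0\ell,\pi_10\rangle T(+):T_2M\to T^2M$, left $\pi_0p=\pi_1p$, right $T(p)$, bottom $0_M$ is a pullback preserved by each $T^k$. It has negatives if there is a natural transformation $n:T\to T$ making each $p_M$ a fibrewise abelian group; $f-g:=\langle f,gn\rangle+$. A differential bundle $\mathsf{q}=(q:E\to M,+_q,0_q,\lambda)$ is an additive bundle with a lift $\lambda:E\to T(E)$ such that: the wide pullbacks $E_n$ are preserved by each $T^k$; for all $n,m$ the pullback of $E_n\to M$ along $T_mM\to M$ exists and is preserved by each $T^k$; $(\lambda,0_M)$ is an additive bundle morphism from $q$ to $(T(q),T(+_q),T(0_q))$; $(\lambda,0_q)$ is an additive bundle morphism from $q$ to $(p_E,+_E,0_E)$; with $\mu:=\langle\pi_0\lambda,\pi_10\rangle T(+_q):E_2\to T(E)$, the square with top $\mu$, left $\pi_0q=\pi_1q:E_2\to M$, right $T(q)$, bottom $0_M$ is a pullback (preserved by each $T^k$); and $\lambda\ell_E=\lambda T(\lambda)$. A vertical connection on $\mathsf{q}$ is a map $K:T(E)\to E$ with $\lambda K=1_E$, $Kq=pq$, $K\lambda=\ell T(K)$ and $K\lambda=T(\lambda)cT(K)$ (i.e. a retraction of $\lambda$ that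 is a linear bundle morphism for both bundle structures $p_E$ and $T(q)$ on $T(E)$). A horizontal connection is a map $H:T(M)\times_ME\to T(E)$ (pullback of $p_M$ and $q$, $\pi_0$ to $T(M)$, $\pi_1$ to $E$) with $HT(q)=\pi_0$, $Hp=\pi_1$, $H\ell=(\ell\times0)T(H)$ and $HT(\lambda)c=(0\times\lambda)T(H)$. A connection is a pair $(K,H)$ of a vertical and a horizontal connection with $HK=\pi_1q0_q$ and $\langle K,p\rangle\mu+UH=1_{T(E)}$ (sum in $p_E$), where $U=\langle T(q),p\rangle:T(E)\to T(M)\times_ME$. *)

(* Defs.v *)
From mathcomp Require Import all_boot.

Set Implicit Arguments.
Unset Strict Implicit.
Unset Printing Implicit Defensive.

Declare Scope cat_scope.
Delimit Scope cat_scope with cat.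
Local Open Scope cat_scope.

Record category := Category {
  Ob :> Type;
  Hom : Ob -> Ob -> Type;
  idm : forall A, Hom A A;
  comp : forall A B D, Hom A B -> Hom B D -> Hom A D;
  comp1m : forall A B (f : Hom A B), comp (idm A) f = f;
  compm1 : forall A B (f : Hom A B), comp f (idm B) = f;
  compA : forall A B D F (f : Hom A B) (g : Hom B D) (h : Hom D F),
    comp f (comp g h) = comp (comp f g) h }.

Arguments Hom {c} A B.
Arguments idm {c} A.
Arguments comp {c A B D} f g.

Notation "A ~> B" := (Hom A B) (at level 90, B at level 89) : cat_scope.
(* diagrammatic order: first f, then g *)
Notation "f ;; g" := (comp f g) (at level 40, left associativity) : cat_scope.

Record endofunctor (X : category) := Endofunctor {
  fob :> X -> X;
  fmap : forall A B : X, (A ~> B) -> (fob A ~> fob B);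
  fmap1 : forall A : X, fmap (idm A) = idm (fob A);
  fmapM : forall (A B D : X) (f : A ~> B) (g : B ~> D),
    fmap (f ;; g) = fmap f ;; fmap g }.

Arguments fmap {X} e {A B} f.

Fixpoint fmapn (X : category) (F : endofunctor X) (k : nat) (A B : X)
    (f : A ~> B) : iter k F A ~> iter k F B :=
  match k return iter k F A ~> iter k F B with
  | 0 => f
  | k'.+1 => fmap F (fmapn F k' f)
  end.

Arguments fmapn {X} F k {A B} f.

(* The universal property is kept in Type, with the mediating map as a
   component, so that induced maps <x, y> are terms; such a structure is
   determined by the cone, by the uniqueness clause. *)
Record is_pullback (X : category) (A B D P : X) (f : A ~> D) (g : B ~> D)
    (a : P ~> A) (b : P ~> B) : Type := IsPullback {
  pb_comm : a ;; f = b ;; g;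
  pb_lift : forall (Z : X) (x : Z ~> A) (y : Z ~> B),
    x ;; f = y ;; g -> Z ~> P;
  pb_lift0 : forall (Z : X) (x : Z ~> A) (y : Z ~> B) (e : x ;; f = y ;; g),
    pb_lift e ;; a = x;
  pb_lift1 : forall (Z : X) (x : Z ~> A) (y : Z ~> B) (e : x ;; f = y ;; g),
    pb_lift e ;; b = y;
  pb_uniq : forall (Z : X) (u v : Z ~> P),
    u ;; a = v ;; a -> u ;; b = v ;; b -> u = v }.

Record preserved_pullback (X : category) (T : endofunctor X) (A B D : X)
    (f : A ~> D) (g : B ~> D) := PreservedPullback {
  pp_ob : X;
  pp_pi0 : pp_ob ~> A;
  pp_pi1 : pp_ob ~> B;
  pp_is : forall k, is_pullback (fmapn T k f) (fmapn T k g)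
                                (fmapn T k pp_pi0) (fmapn T k pp_pi1) }.

(* The n-fold wide pullback P of q along itself, i.e. the n-th power of q
   in the slice over M, with structure map r : P ~> M; the map r is part of
   the cone so that n = 0 is covered. *)
Record is_wide_pullback (X : category) (E M : X) (q : E ~> M) (n : nat)
    (P : X) (r : P ~> M) (pi : 'I_n -> P ~> E) : Type := IsWidePullback {
  wp_comm : forall i, pi i ;; q = r;
  wp_lift : forall (Z : X) (h : Z ~> M) (x : 'I_n -> Z ~> E),
    (forall i, x i ;; q = h) -> Z ~> P;
  wp_lift_leg : forall (Z : X) (h : Z ~> M) (x : 'I_n -> Z ~> E)
    (e : forall i, x i ;; q = h), wp_lift e ;; r = h;
  wp_lift_pi : forall (Z : X) (h : Z ~> M) (x : 'I_n -> Z ~> E)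
    (e : forall i, x i ;; q = h) i, wp_lift e ;; pi i = x i;
  wp_uniq : forall (Z : X) (u v : Z ~> P),
    u ;; r = v ;; r -> (forall i, u ;; pi i = v ;; pi i) -> u = v }.

Lemma wp2_legs (X : category) (E M Z : X) (q : E ~> M) (x y : Z ~> E) :
  x ;; q = y ;; q ->
  forall i : 'I_2, (if i == ord0 then x else y) ;; q = x ;; q.
Proof. by move=> e i; case: ifP. Qed.

Definition wp2_pullback (X : category) (E M P : X) (q : E ~> M) (r : P ~> M)
    (pi : 'I_2 -> P ~> E) (W : is_wide_pullback q r pi) :
  is_pullback q q (pi ord0) (pi ord_max).
Proof.
refine (@IsPullback _ _ _ _ _ _ _ _ _ _
  (fun Z x y e => wp_lift W (wp2_legs e)) _ _ _).
- by rewrite !(wp_comm W).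
- by move=> Z x y e; rewrite wp_lift_pi.
- by move=> Z x y e; rewrite wp_lift_pi.
- move=> Z u v e0 e1; apply: (wp_uniq W).
    by rewrite -(wp_comm W ord0) !compA e0.
  move=> i; have [->//|ni] := eqVneq i ord0.
  suff -> : i = ord_max by [].
  by apply/val_inj; case: i ni => [[|[|?]]].
Defined.

Record wide_power (X : category) (E M : X) (q : E ~> M) (n : nat) :=
  WidePower {
  wp_ob : X;
  wp_leg : wp_ob ~> M;
  wp_pi : 'I_n -> wp_ob ~> E;
  wp_is : is_wide_pullback q wp_leg wp_pi }.

Record bundle_data (X : category) (E M : X) (q : E ~> M) := BundleData {
  bn : forall n, wide_power q n;
  bplus : wp_ob (bn 2) ~> E;
  bzero : M ~> E }.

Section Bundle.
Variables (X : category) (E M : X) (q : E ~> M) (A : bundle_data q).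

Definition b2 : X := wp_ob (bn A 2).
Definition bpi0 : b2 ~> E := wp_pi (bn A 2) ord0.
Definition bpi1 : b2 ~> E := wp_pi (bn A 2) ord_max.

Definition b2_pullback : is_pullback q q bpi0 bpi1 :=
  wp2_pullback (wp_is (bn A 2)).

(* <x, y> and <x, y>+ *)
Definition bpair (Z : X) (x y : Z ~> E) (e : x ;; q = y ;; q) : Z ~> b2 :=
  pb_lift b2_pullback e.
Definition badd (Z : X) (x y : Z ~> E) (e : x ;; q = y ;; q) : Z ~> E :=
  bpair e ;; bplus A.

Lemma badd_irr (Z : X) (x y : Z ~> E) (e e' : x ;; q = y ;; q) :
  badd e = badd e'.
Proof.
congr (_ ;; _); apply: (pb_uniq b2_pullback).
  by rewrite !(pb_lift0 b2_pullback).
by rewrite !(pb_lift1 b2_pullback).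
Qed.

Lemma badd_q (plus_q : bplus A ;; q = bpi0 ;; q) (Z : X) (x y : Z ~> E)
  (e : x ;; q = y ;; q) : badd e ;; q = x ;; q.
Proof.
by rewrite /badd -compA plus_q compA (pb_lift0 b2_pullback).
Qed.

Lemma bzero_over (zero_q : bzero A ;; q = idm M) (Z : X) (x : Z ~> E) :
  x ;; q = x ;; q ;; bzero A ;; q.
Proof. by rewrite -[RHS]compA zero_q compm1. Qed.

Lemma badd_assocl (plus_q : bplus A ;; q = bpi0 ;; q) (Z : X)
  (x y z : Z ~> E) (e : x ;; q = y ;; q) (e' : y ;; q = z ;; q) :
  badd e ;; q = z ;; q.
Proof. by rewrite badd_q // e e'. Qed.

Lemma badd_assocr (plus_q : bplus A ;; q = bpi0 ;; q) (Z : X)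
  (x y z : Z ~> E) (e : x ;; q = y ;; q) (e' : y ;; q = z ;; q) :
  x ;; q = badd e' ;; q.
Proof. by rewrite badd_q. Qed.

(* Commutative monoid in the slice over M, on generalized elements. *)
Record is_additive_bundle : Prop := IsAdditiveBundle {
  bplus_q : bplus A ;; q = bpi0 ;; q;
  bzero_q : bzero A ;; q = idm M;
  baddA : forall (Z : X) (x y z : Z ~> E)
    (e : x ;; q = y ;; q) (e' : y ;; q = z ;; q),
    badd (badd_assocr bplus_q e e') = badd (badd_assocl bplus_q e e');
  baddC : forall (Z : X) (x y : Z ~> E) (e : x ;; q = y ;; q),
    badd e = badd (esym e);
  badd0 : forall (Z : X) (x : Z ~> E), badd (bzero_over bzero_q x) = x }.

End Bundle.

Lemma bpair_over (X : category) (E M E' M' : X) (q : E ~> M) (q' : E' ~> M')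
  (A : bundle_data q) (f1 : E ~> E') (f0 : M ~> M') :
  f1 ;; q' = q ;; f0 -> bpi0 A ;; f1 ;; q' = bpi1 A ;; f1 ;; q'.
Proof. by move=> e; rewrite -!compA e !compA (pb_comm (b2_pullback A)). Qed.

Record additive_bundle_morphism (X : category) (E M E' M' : X)
    (q : E ~> M) (q' : E' ~> M') (A : bundle_data q) (A' : bundle_data q')
    (f1 : E ~> E') (f0 : M ~> M') : Prop := AdditiveBundleMorphism {
  abm_q : f1 ;; q' = q ;; f0;
  abm_plus : bplus A ;; f1 = badd A' (bpair_over A abm_q);
  abm_zero : bzero A ;; f1 = f0 ;; bzero A' }.

Definition bundle_preserved (X : category) (T : endofunctor X) (E M : X)
    (q : E ~> M) (A : bundle_data q) : Type :=
  forall k n, is_wide_pullback (fmapn T k q) (fmapn T k (wp_leg (bn A n)))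
                               (fun i => fmapn T k (wp_pi (bn A n) i)).

(* (T(q), T(+_q), T(0_q)), with wide powers T(E_n) *)
Definition map_bundle (X : category) (T : endofunctor X) (E M : X)
    (q : E ~> M) (A : bundle_data q) (pres : bundle_preserved T A) :
  bundle_data (fmap T q) :=
  @BundleData X (T E) (T M) (fmap T q)
    (fun n => WidePower (pres 1 n))
    (fmap T (bplus A)) (fmap T (bzero A)).

Lemma bundle_mu_over (X : category) (T : endofunctor X) (E M : X)
  (q : E ~> M) (A : bundle_data q) (lam zE : E ~> T E) (zM : M ~> T M) :
  lam ;; fmap T q = q ;; zM -> zE ;; fmap T q = q ;; zM ->
  bpi0 A ;; lam ;; fmap T q = bpi1 A ;; zE ;; fmap T q.
Proof.
by move=> el ez; rewrite -!compA el ez !compA (pb_comm (b2_pullback A)).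
Qed.

(* <pi_0 lam, pi_1 zE> T(+_q); below zE = 0_E and zM = 0_M *)
Definition bundle_mu (X : category) (T : endofunctor X) (E M : X)
    (q : E ~> M) (A : bundle_data q) (pres : bundle_preserved T A)
    (lam zE : E ~> T E) (zM : M ~> T M)
    (el : lam ;; fmap T q = q ;; zM) (ez : zE ;; fmap T q = q ;; zM) :
  b2 A ~> T E :=
  badd (map_bundle pres) (bundle_mu_over A el ez).

Lemma tmap2_over (X : category) (T : endofunctor X)
  (p : forall M : X, T M ~> M)
  (p_nat : forall (M N : X) (f : M ~> N), fmap T f ;; p N = p M ;; f)
  (B : forall M : X, bundle_data (p M)) (M N : X) (f : M ~> N) :
  bpi0 (B M) ;; fmap T f ;; p N = bpi1 (B M) ;; fmap T f ;; p N.
Proof. exact: bpair_over (p_nat M N f). Qed.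

(* the action of T_2 on maps *)
Definition tmap2 (X : category) (T : endofunctor X)
    (p : forall M : X, T M ~> M)
    (p_nat : forall (M N : X) (f : M ~> N), fmap T f ;; p N = p M ;; f)
    (B : forall M : X, bundle_data (p M)) (M N : X) (f : M ~> N) :
  b2 (B M) ~> b2 (B N) :=
  bpair (B N) (tmap2_over p_nat B f).

Record tangent_structure (X : category) := TangentStructure {
  tT :> endofunctor X;
  tp : forall M : X, tT M ~> M;
  tbundle : forall M : X, bundle_data (tp M);
  tl : forall M : X, tT M ~> tT (tT M);
  tc : forall M : X, tT (tT M) ~> tT (tT M);

  tp_nat : forall (M N : X) (f : M ~> N), fmap tT f ;; tp N = tp M ;; f;
  tzero_nat : forall (M N : X) (f : M ~> N),
    bzero (tbundle M) ;; fmap tT f = f ;; bzero (tbundle N);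
  tplus_nat : forall (M N : X) (f : M ~> N),
    bplus (tbundle M) ;; fmap tT f = tmap2 tp_nat tbundle f ;; bplus (tbundle N);
  tl_nat : forall (M N : X) (f : M ~> N),
    tl M ;; fmap tT (fmap tT f) = fmap tT f ;; tl N;
  tc_nat : forall (M N : X) (f : M ~> N),
    tc M ;; fmap tT (fmap tT f) = fmap tT (fmap tT f) ;; tc N;

  tadditive : forall M : X, is_additive_bundle (tbundle M);
  tpreserved : forall M : X, bundle_preserved tT (tbundle M);

  tl_additive : forall M : X,
    additive_bundle_morphism (tbundle M) (map_bundle (@tpreserved M))
      (tl M) (bzero (tbundle M));
  tc_additive : forall M : X,
    additive_bundle_morphism (map_bundle (@tpreserved M)) (tbundle (tT M))
      (tc M) (idm (tT M));

  tcc : forall M : X, tc M ;; tc M = idm (tT (tT M));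
  tlc : forall M : X, tl M ;; tc M = tl M;
  tll : forall M : X, tl M ;; tl (tT M) = tl M ;; fmap tT (tl M);
  tc_braid : forall M : X,
    fmap tT (tc M) ;; tc (tT M) ;; fmap tT (tc M)
      = tc (tT M) ;; fmap tT (tc M) ;; tc (tT M);
  tlcc : forall M : X,
    tl (tT M) ;; fmap tT (tc M) ;; tc (tT M) = tc M ;; fmap tT (tl M);

  tuniversal : forall (M : X) k,
    is_pullback (fmapn tT k (fmap tT (tp M))) (fmapn tT k (bzero (tbundle M)))
      (fmapn tT k (bundle_mu (@tpreserved M) (abm_q (tl_additive M))
                             (tzero_nat (tp M))))
      (fmapn tT k (bpi0 (tbundle M) ;; tp M)) }.

Definition tzero (X : category) (T : tangent_structure X) (M : X) :
  M ~> T M := bzero (tbundle T M).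

Record negatives (X : category) (T : tangent_structure X) := Negatives {
  tneg :> forall M : X, T M ~> T M;
  tneg_nat : forall (M N : X) (f : M ~> N),
    tneg M ;; fmap T f = fmap T f ;; tneg N;
  tneg_p : forall M : X, tneg M ;; tp T M = tp T M;
  taddN : forall (M Z : X) (x : Z ~> T M)
    (e : x ;; tp T M = x ;; tneg M ;; tp T M),
    badd (tbundle T M) e = x ;; tp T M ;; tzero T M }.

Lemma tsub_over (X : category) (T : tangent_structure X) (n : negatives T)
  (M Z : X) (f g : Z ~> T M) :
  f ;; tp T M = g ;; tp T M -> f ;; tp T M = g ;; n M ;; tp T M.
Proof. by move=> e; rewrite -compA tneg_p. Qed.

(* f - g *)
Definition tsub (X : category) (T : tangent_structure X) (n : negatives T)
    (M Z : X) (f g : Z ~> T M) (e : f ;; tp T M = g ;; tp T M) : Z ~> T M :=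
  badd (tbundle T M) (tsub_over n e).

Record differential_bundle (X : category) (T : tangent_structure X)
    (E M : X) (q : E ~> M) := DifferentialBundle {
  dbundle :> bundle_data q;
  dlift : E ~> T E;
  dadditive : is_additive_bundle dbundle;
  dpreserved : bundle_preserved T dbundle;
  (* the pullbacks of T_m M -> M and E_n -> M *)
  dpb : forall n m, preserved_pullback T
    (wp_leg (bn (tbundle T M) m)) (wp_leg (bn dbundle n));
  dlift_T : additive_bundle_morphism dbundle (map_bundle dpreserved)
    dlift (tzero T M);
  dlift_p : additive_bundle_morphism dbundle (tbundle T E)
    dlift (bzero dbundle);
  duniversal : forall k,
    is_pullback (fmapn T k (fmap T q)) (fmapn T k (tzero T M))
      (fmapn T k (bundle_mu dpreserved (abm_q dlift_T) (tzero_nat T q)))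
      (fmapn T k (bpi0 dbundle ;; q));
  dlift_l : dlift ;; tl T E = dlift ;; fmap T dlift }.

Lemma fmapnM (X : category) (T : endofunctor X) k (A B D : X)
  (f : A ~> B) (g : B ~> D) : fmapn T k (f ;; g) = fmapn T k f ;; fmapn T k g.
Proof. by elim: k => //= k ->; rewrite fmapM. Qed.

Section DifferentialBundle.
Variables (X : category) (T : tangent_structure X) (E M : X) (q : E ~> M)
  (D : differential_bundle T q).

Definition dmu : b2 D ~> T E :=
  bundle_mu (dpreserved D) (abm_q (dlift_T D)) (tzero_nat T q).

Lemma dmu_p : dmu ;; tp T E = bpi1 D.
Proof.
rewrite /dmu /bundle_mu /badd /= -compA tp_nat compA.
set u := bpair _ _.
have e0 : u ;; fmap T (bpi0 D) = bpi0 D ;; dlift D.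
  exact: (pb_lift0 (b2_pullback (map_bundle (dpreserved D)))).
have e1 : u ;; fmap T (bpi1 D) = bpi1 D ;; tzero T E.
  exact: (pb_lift1 (b2_pullback (map_bundle (dpreserved D)))).
have zp : tzero T E ;; tp T E = idm E := bzero_q (tadditive T E).
have n0 : tp T (wp_ob (bn D 2)) ;; bpi0 D = fmap T (bpi0 D) ;; tp T E.
  exact: esym (tp_nat T (bpi0 D)).
have n1 : tp T (wp_ob (bn D 2)) ;; bpi1 D = fmap T (bpi1 D) ;; tp T E.
  exact: esym (tp_nat T (bpi1 D)).
have e := bzero_over (bzero_q (dadditive D)) (bpi1 D).
have -> : u ;; tp T (wp_ob (bn D 2)) = bpair D (esym e).
  have w0 : bpair D (esym e) ;; bpi0 D = bpi1 D ;; q ;; bzero D.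
    exact: (pb_lift0 (b2_pullback D)).
  have w1 : bpair D (esym e) ;; bpi1 D = bpi1 D.
    exact: (pb_lift1 (b2_pullback D)).
  apply: (pb_uniq (b2_pullback D)); rewrite ?w0 ?w1 -[LHS]compA.
    rewrite n0 compA e0 -compA (abm_q (dlift_p D)) compA.
    by rewrite (pb_comm (b2_pullback D)).
  by rewrite n1 compA e1 -compA zp compm1.
have := baddC (dadditive D) (esym e).
rewrite esymK /badd => ->.
rewrite -/(badd _ _) (badd_irr _ _ (bzero_over (bzero_q (dadditive D)) _)).
exact: (badd0 (dadditive D)).
Qed.

(* T(M) x_M E, taken as the case n = m = 1 of [dpb]; E_1 and T_1 M are
   isomorphic to E and T(M) through their only projection *)
Definition dhor : X := pp_ob (dpb D 1 1).
Definition dpi0 : dhor ~> T M :=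
  pp_pi0 (dpb D 1 1) ;; wp_pi (bn (tbundle T M) 1) ord0.
Definition dpi1 : dhor ~> E := pp_pi1 (dpb D 1 1) ;; wp_pi (bn D 1) ord0.

Definition dhor_pullback k :
  is_pullback (fmapn T k (tp T M)) (fmapn T k q)
              (fmapn T k dpi0) (fmapn T k dpi1).
Proof.
have W0 := @tpreserved _ T M k 1.
have W1 := dpreserved D k 1.
have P := pp_is (dpb D 1 1) k.
have e0 (Z : X) (x : Z ~> iter k T (T M)) :
  forall i : 'I_1, x ;; fmapn T k (tp T M) = x ;; fmapn T k (tp T M) by [].
have e1 (Z : X) (x : Z ~> iter k T (T M)) (y : Z ~> iter k T E) :
  x ;; fmapn T k (tp T M) = y ;; fmapn T k q ->
  forall i : 'I_1, y ;; fmapn T k q = x ;; fmapn T k (tp T M) by [].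
have e2 (Z : X) (x : Z ~> iter k T (T M)) (y : Z ~> iter k T E)
   (e : x ;; fmapn T k (tp T M) = y ;; fmapn T k q) :
   wp_lift W0 (e0 Z x) ;; fmapn T k (wp_leg (bn (tbundle T M) 1))
   = wp_lift W1 (e1 Z x y e) ;; fmapn T k (wp_leg (bn D 1)).
  by rewrite !wp_lift_leg.
refine (@IsPullback _ _ _ _ _ _ _ _ _ _
  (fun Z x y e => pb_lift P (e2 Z x y e)) _ _ _).
- rewrite !fmapnM -!compA (wp_comm W0) (wp_comm W1); exact: (pb_comm P).
- by move=> Z x y e; rewrite fmapnM compA pb_lift0 (wp_lift_pi W0).
- by move=> Z x y e; rewrite fmapnM compA pb_lift1 (wp_lift_pi W1).
- move=> Z u v; rewrite !fmapnM !compA => h0 h1; apply: (pb_uniq P).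
    apply: (wp_uniq W0) => [|i]; last by rewrite (ord1 i).
    by rewrite -(wp_comm W0 ord0) !compA h0.
  apply: (wp_uniq W1) => [|i]; last by rewrite (ord1 i).
  by rewrite -(wp_comm W1 ord0) !compA h1.
Defined.

(* f x g = <pi_0 f, pi_1 g>, as a map T(M) x_M E -> T(T(M) x_M E) *)
Lemma dprod_over (f : T M ~> T (T M)) (g : E ~> T E) (h : M ~> T M) :
  f ;; fmap T (tp T M) = tp T M ;; h -> g ;; fmap T q = q ;; h ->
  dpi0 ;; f ;; fmap T (tp T M) = dpi1 ;; g ;; fmap T q.
Proof.
by move=> ef eg; rewrite -!compA ef eg !compA (pb_comm (dhor_pullback 0)).
Qed.

Definition dprod (f : T M ~> T (T M)) (g : E ~> T E) (h : M ~> T M)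
    (ef : f ;; fmap T (tp T M) = tp T M ;; h)
    (eg : g ;; fmap T q = q ;; h) : dhor ~> T dhor :=
  pb_lift (dhor_pullback 1) (dprod_over ef eg).

(* U = <T(q), p> *)
Definition dU : T E ~> dhor :=
  pb_lift (dhor_pullback 0) (tp_nat T q).

Record vertical_connection (K : T E ~> E) : Prop := VerticalConnection {
  vc_retract : dlift D ;; K = idm E;
  vc_q : K ;; q = tp T E ;; q;
  vc_linear_p : K ;; dlift D = tl T E ;; fmap T K;
  vc_linear_T : K ;; dlift D = fmap T (dlift D) ;; tc T E ;; fmap T K }.

Record horizontal_connection (H : dhor ~> T E) : Prop :=
  HorizontalConnection {
  hc_Tq : H ;; fmap T q = dpi0;
  hc_p : H ;; tp T E = dpi1;
  (* H l = (l x 0) T(H) *)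
  hc_linear_p : H ;; tl T E
    = dprod (abm_q (tl_additive T M)) (tzero_nat T q) ;; fmap T H;
  (* H T(lam) c = (0 x lam) T(H) *)
  hc_linear_T : H ;; fmap T (dlift D) ;; tc T E
    = dprod (tzero_nat T (tp T M)) (abm_q (dlift_T D)) ;; fmap T H }.

(* <K, p> mu *)
Definition dvert (K : T E ~> E) (e : K ;; q = tp T E ;; q) : T E ~> T E :=
  bpair D e ;; dmu.

Lemma dvert_p (K : T E ~> E) (e : K ;; q = tp T E ;; q) :
  dvert e ;; tp T E = tp T E.
Proof. by rewrite /dvert -compA dmu_p (pb_lift1 (b2_pullback D)). Qed.

Lemma dvert_sub_over (K : T E ~> E) (e : K ;; q = tp T E ;; q) :
  idm (T E) ;; tp T E = dvert e ;; tp T E.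
Proof. by rewrite comp1m dvert_p. Qed.

Lemma dU_hor_over (H : dhor ~> T E) (K : T E ~> E)
  (e : K ;; q = tp T E ;; q) (eH : H ;; tp T E = dpi1) :
  dvert e ;; tp T E = dU ;; H ;; tp T E.
Proof. by rewrite dvert_p -compA eH (pb_lift1 (dhor_pullback 0)). Qed.

Record connection (K : T E ~> E) (H : dhor ~> T E) : Prop := Connection {
  cn_vertical : vertical_connection K;
  cn_horizontal : horizontal_connection H;
  cn_HK : H ;; K = dpi1 ;; q ;; bzero D;
  cn_sum : badd (tbundle T E)
      (dU_hor_over (vc_q cn_vertical) (hc_p cn_horizontal)) = idm (T E) }.

End DifferentialBundle.

Arguments horizontal_connection {X T E M q} D H.
Arguments connection {X T E M q} D K H.

(* Main.v *)
From mathcomp Require Import all_boot.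
Require Import Defs.
Local Open Scope cat_scope.

Set Implicit Arguments.
Unset Strict Implicit.

(** Write v = <K, p> mu for the vertical part of a tangent vector to E and
d = 1 - v for the complementary horizontal part, the difference being taken
in the bundle p_E.  The new horizontal connection is H = J d.

The retraction [K] is additive, from the bundle p_E to q as well as from T(q)
to q: its linearity expresses K followed by the lift as a composite of
additive maps, and the lift, being split by [K], reflects sums.  Hence
v K = K, so that d K = K - K = 0, which gives the equation H K = 0.

Postcomposition with d keeps J a horizontal connection as soon as d fixes p
and T(q) and commutes with l and with T(lambda) c
([horizontal_connection_comp]).  Since d + v = 1, T(q) is fixed because v is
sent to zero by T(q), and the two commutation rules for d follow by
cancellation from those for v ([dvert_l], [dvert_Tlift_c]), which hold since v
is assembled from K, lambda, p and 0, all of which are linear.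

For the equation v + U H = 1, the maps T(q), p and K : T(E) -> E are jointly
monic ([Tq_p_K_jointly_monic]): two vectors with the same images under T(q)
and p differ by a vertical vector, a vertical vector is determined by its
images under K and p by the universal property of the lift, and K is
additive.  Both sides of the equation agree after T(q), p and K.

Sums are handled throughout as ternary relations on generalized elements.
This avoids carrying the proofs that two summands lie over the same point,
and makes sense equally for q, T(q) and T^2(q). *)

(** * Sums as relations *)

(** A partial binary operation on E, as a span of pairs of summands with an
output map.  Only the cone is recorded, with no limit property, so that a
functor can be applied to it. *)
Record addition (X : category) (E : X) := Addition {
  add_dom : X;
  add_l : add_dom ~> E;
  add_r : add_dom ~> E;
  add_out : add_dom ~> E }.

Definition is_sum (X : category) (E : X) (a : addition E) (Z : X)
    (x y s : Z ~> E) : Prop :=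
  exists u : Z ~> add_dom a,
    [/\ u ;; add_l a = x, u ;; add_r a = y & u ;; add_out a = s].

Definition preserves_sums (X : category) (E E' : X)
    (a : addition E) (b : addition E') (f : E ~> E') : Prop :=
  is_sum b (add_l a ;; f) (add_r a ;; f) (add_out a ;; f).

Definition single_valued (X : category) (E : X) (a : addition E) : Prop :=
  forall (Z : X) (x y s t : Z ~> E), is_sum a x y s -> is_sum a x y t -> s = t.

Definition fadd (X : category) (T : endofunctor X) (E : X) (a : addition E) :
    addition (T E) :=
  Addition (fmap T (add_l a)) (fmap T (add_r a)) (fmap T (add_out a)).

Definition bundle_add (X : category) (E M : X) (q : E ~> M)
    (A : bundle_data q) : addition E :=
  Addition (bpi0 A) (bpi1 A) (bplus A).

Section Sums.
Variables (X : category) (T : endofunctor X).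

Lemma is_sum_pre (E Z' Z : X) (a : addition E) (h : Z' ~> Z)
    (x y s : Z ~> E) :
  is_sum a x y s -> is_sum a (h ;; x) (h ;; y) (h ;; s).
Proof. by case=> u [<- <- <-]; exists (h ;; u); rewrite !compA. Qed.

Lemma is_sum_image (E E' Z : X) (a : addition E) (b : addition E')
    (f : E ~> E') (x y s : Z ~> E) :
  preserves_sums a b f -> is_sum a x y s ->
  is_sum b (x ;; f) (y ;; f) (s ;; f).
Proof. by move=> hf [u [<- <- <-]]; rewrite -!compA; apply: is_sum_pre. Qed.

Lemma preserves_sums_comp (E E' E'' : X) (a : addition E) (b : addition E')
    (d : addition E'') (f : E ~> E') (g : E' ~> E'') :
  preserves_sums a b f -> preserves_sums b d g -> preserves_sums a d (f ;; g).
Proof.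
by rewrite /preserves_sums !compA => hf hg; apply: is_sum_image hg hf.
Qed.

Lemma is_sum_fmap (E Z : X) (a : addition E) (x y s : Z ~> E) :
  is_sum a x y s -> is_sum (fadd T a) (fmap T x) (fmap T y) (fmap T s).
Proof. by case=> u [<- <- <-]; exists (fmap T u); rewrite !fmapM. Qed.

Lemma preserves_sums_fmap (E E' : X) (a : addition E) (b : addition E')
    (f : E ~> E') :
  preserves_sums a b f -> preserves_sums (fadd T a) (fadd T b) (fmap T f).
Proof. by move/is_sum_fmap; rewrite !fmapM. Qed.

Lemma single_valued_pullback (E M : X) (a : addition E) (f g : E ~> M) :
  is_pullback f g (add_l a) (add_r a) -> single_valued a.
Proof.
move=> P Z x y s t [u [u0 u1 <-]] [v [v0 v1 <-]].
by congr (_ ;; _); apply: (pb_uniq P); rewrite ?v0 ?v1.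
Qed.

End Sums.

(** * Sums in additive bundles *)

Section BundleSums.
Variables (X : category) (E M : X) (q : E ~> M) (A : bundle_data q).

Lemma badd_is_sum (Z : X) (x y : Z ~> E) (e : x ;; q = y ;; q) :
  is_sum (bundle_add A) x y (badd A e).
Proof.
exists (bpair A e); split=> //=.
  exact: (pb_lift0 (b2_pullback A)).
exact: (pb_lift1 (b2_pullback A)).
Qed.

Lemma bundle_sum_uniq : single_valued (bundle_add A).
Proof. exact: (single_valued_pullback (b2_pullback A : 
  is_pullback q q (add_l (bundle_add A)) (add_r (bundle_add A)))). Qed.

Lemma is_sum_over (Z : X) (x y s : Z ~> E) :
  is_sum (bundle_add A) x y s -> x ;; q = y ;; q.
Proof. by case=> u [<- <- _]; rewrite -!compA (pb_comm (b2_pullback A)). Qed.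

Lemma is_sum_badd (Z : X) (x y s : Z ~> E) (e : x ;; q = y ;; q) :
  is_sum (bundle_add A) x y s -> badd A e = s.
Proof. exact/bundle_sum_uniq/badd_is_sum. Qed.

Lemma abm_preserves_sums (E' M' : X) (q' : E' ~> M') (A' : bundle_data q')
    (f1 : E ~> E') (f0 : M ~> M') :
  additive_bundle_morphism A A' f1 f0 ->
  preserves_sums (bundle_add A) (bundle_add A') f1.
Proof.
move=> h; rewrite /preserves_sums /= (abm_plus h).
exists (bpair A' (bpair_over A (abm_q h))); split=> //=.
  exact: (pb_lift0 (b2_pullback A')).
exact: (pb_lift1 (b2_pullback A')).
Qed.

Hypothesis hA : is_additive_bundle A.

Lemma is_sum_base (Z : X) (x y s : Z ~> E) :
  is_sum (bundle_add A) x y s -> s ;; q = x ;; q.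
Proof. by case=> u [<- _ <-]; rewrite -!compA (bplus_q hA). Qed.

Lemma is_sum0 (Z : X) (x : Z ~> E) :
  is_sum (bundle_add A) x (x ;; q ;; bzero A) x.
Proof. by rewrite -{3}(badd0 hA x); apply: badd_is_sum. Qed.

Lemma is_sumC (Z : X) (x y s : Z ~> E) :
  is_sum (bundle_add A) x y s -> is_sum (bundle_add A) y x s.
Proof.
move=> h; rewrite -(is_sum_badd (is_sum_over h) h) (baddC hA).
exact: badd_is_sum.
Qed.

Lemma is_sumA (Z : X) (x y z s t : Z ~> E) :
  is_sum (bundle_add A) x y s -> is_sum (bundle_add A) y z t ->
  exists r, is_sum (bundle_add A) x t r /\ is_sum (bundle_add A) s z r.
Proof.
move=> hs ht; have e := is_sum_over hs; have e' := is_sum_over ht.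
rewrite -(is_sum_badd e hs) -(is_sum_badd e' ht).
exists (badd A (badd_assocr (bplus_q hA) e e')); split; first exact: badd_is_sum.
by rewrite baddA; apply: badd_is_sum.
Qed.

(** The single summand [z] is required to be invertible, so this applies in
the bundle q, which need not be a bundle of groups. *)
Lemma is_sum_cancel (Z : X) (x y z z' s : Z ~> E) :
  is_sum (bundle_add A) z z' (z ;; q ;; bzero A) ->
  is_sum (bundle_add A) x z s -> is_sum (bundle_add A) y z s -> x = y.
Proof.
move=> hz.
have sub w : is_sum (bundle_add A) w z s -> is_sum (bundle_add A) s z' w.
  move=> hw; have [r [hr]] := is_sumA hw hz.
  rewrite -(is_sum_over hw) in hr.
  by rewrite (bundle_sum_uniq hr (is_sum0 w)).
by move=> /sub hx /sub hy; apply: bundle_sum_uniq hx hy.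
Qed.

End BundleSums.

(** * Sums of tangent vectors *)

Section TangentSums.
Variables (X : category) (T : tangent_structure X).

Notation padd N := (bundle_add (tbundle T N)).

Lemma fmap_preserves_sums (N N' : X) (f : N ~> N') :
  preserves_sums (padd N) (padd N') (fmap T f).
Proof.
rewrite /preserves_sums /= tplus_nat.
exists (tmap2 (tp_nat T) (tbundle T) f); split=> //=.
  exact: (pb_lift0 (b2_pullback (tbundle T N'))).
exact: (pb_lift1 (b2_pullback (tbundle T N'))).
Qed.

(** Naturality alone: the witnesses are the components of l, and of c below,
at the object of pairs of summands. *)
Lemma tl_preserves_fadd (N : X) (a : addition N) :
  preserves_sums (fadd T a) (fadd T (fadd T a)) (tl T N).
Proof. by exists (tl T (add_dom a)); rewrite /= !tl_nat. Qed.

Lemma tc_preserves_fadd (N : X) (a : addition N) :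
  preserves_sums (fadd T (fadd T a)) (fadd T (fadd T a)) (tc T N).
Proof. by exists (tc T (add_dom a)); rewrite /= !tc_nat. Qed.

Lemma tc_preserves_sums (N : X) :
  preserves_sums (fadd T (padd N)) (padd (T N)) (tc T N).
Proof. exact: (abm_preserves_sums (tc_additive T N)). Qed.

(** Both bundle structures on T^2 make l additive, since l c = l and c
exchanges them. *)
Lemma tl_preserves_sums (N : X) :
  preserves_sums (padd N) (padd (T N)) (tl T N).
Proof.
rewrite -[tl T N]tlc; apply: preserves_sums_comp (tc_preserves_sums N).
exact: (abm_preserves_sums (tl_additive T N)).
Qed.

Lemma tzero_l (N : X) : tzero T N ;; tl T N = tzero T N ;; fmap T (tzero T N).
Proof. by rewrite (abm_zero (tl_additive T N)) tzero_nat. Qed.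

Lemma tzero_c (N : X) : tzero T (T N) ;; tc T N = fmap T (tzero T N).
Proof.
have := abm_zero (tc_additive T N); rewrite comp1m /= => h.
by rewrite [tzero T (T N)]/tzero -h -compA tcc compm1.
Qed.

Lemma tc_p (N : X) : tc T N ;; fmap T (tp T N) = tp T (T N).
Proof.
have := abm_q (tc_additive T N); rewrite compm1 => h.
by rewrite -h compA tcc comp1m.
Qed.

Lemma tl_p (N : X) : tl T N ;; fmap T (tp T N) = tp T N ;; tzero T N.
Proof. exact: (abm_q (tl_additive T N)). Qed.

Variable n : negatives T.

Lemma neg_is_sum (N Z : X) (x : Z ~> T N) :
  is_sum (padd N) x (x ;; n N) (x ;; tp T N ;; bzero (tbundle T N)).
Proof.
have e : x ;; tp T N = x ;; n N ;; tp T N by rewrite -compA tneg_p.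
by rewrite -(taddN e); apply: badd_is_sum.
Qed.

Lemma tangent_cancel (N Z : X) (x y z s : Z ~> T N) :
  is_sum (padd N) x z s -> is_sum (padd N) y z s -> x = y.
Proof. by have h := neg_is_sum z; apply: (is_sum_cancel (tadditive T N) h). Qed.

Lemma tsub_is_sum (N Z : X) (f g : Z ~> T N) (e : f ;; tp T N = g ;; tp T N) :
  is_sum (padd N) (tsub n e) g f.
Proof.
have hN := tadditive T N.
have [r [hr]] := is_sumA hN (badd_is_sum _ (tsub_over n e))
                            (is_sumC hN (neg_is_sum g)).
by rewrite -e in hr; rewrite (bundle_sum_uniq hr (is_sum0 hN f)).
Qed.

End TangentSums.

(** * The vertical and horizontal parts defined by a vertical connection *)

Section VerticalConnection.
Variables (X : category) (T : tangent_structure X) (E M : X) (q : E ~> M)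
  (D : differential_bundle T q) (K : T E ~> E).

Notation padd N := (bundle_add (tbundle T N)).
Notation qadd := (bundle_add D).

(** The lift is additive from q to p_E and split by [K].  That the summands
[x] and [y] lie over the same point of M is recovered from their lifts, by
projecting along p and then q. *)
Lemma lift_reflects_sums (Z : X) (x y s : Z ~> E) :
  dlift D ;; K = idm E ->
  is_sum (padd E) (x ;; dlift D) (y ;; dlift D) (s ;; dlift D) ->
  is_sum qadd x y s.
Proof.
move=> hK h.
have lq w : w ;; dlift D ;; tp T E ;; q = w ;; q :> (Z ~> M).
  by rewrite -!compA (compA (dlift D)) (abm_q (dlift_p D)) -compA
    (bzero_q (dadditive D)) compm1.
have e : x ;; q = y ;; q by rewrite -lq (is_sum_over h) lq.
have := is_sum_image (abm_preserves_sums (dlift_p D)) (badd_is_sum D e).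
move=> /bundle_sum_uniq /(_ h) /(congr1 (fun f => f ;; K)).
by rewrite -!compA hK !compm1 => <-; apply: badd_is_sum.
Qed.

Hypothesis hK : vertical_connection D K.

Let v : T E ~> T E := dvert D (vc_q hK).

(** After the lift, K is l T(K), a composite of maps additive over p. *)
Lemma vconn_preserves_tangent_sums : preserves_sums (padd E) qadd K.
Proof.
apply: lift_reflects_sums (vc_retract hK) _.
rewrite -!compA (vc_linear_p hK).
exact: preserves_sums_comp (tl_preserves_sums T E) (fmap_preserves_sums T K).
Qed.

(** After the lift, K is T(lambda) c T(K); here T(lambda) sends sums of T(q)
to sums of T(p), which c sends to sums of p. *)
Lemma vconn_preserves_bundle_sums : preserves_sums (fadd T qadd) qadd K.
Proof.
apply: lift_reflects_sums (vc_retract hK) _.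
rewrite -!compA (vc_linear_T hK).
apply: preserves_sums_comp (fmap_preserves_sums T K).
apply: preserves_sums_comp (tc_preserves_sums T E).
exact/preserves_sums_fmap/(abm_preserves_sums (dlift_p D)).
Qed.

(** At a zero vector l agrees with 0 T(0), so 0 K lambda = 0 K 0; projecting
along p identifies 0 K with a zero of q. *)
Lemma vconn_zero : tzero T E ;; K = q ;; bzero D.
Proof.
have zp : tzero T E ;; tp T E = idm E := bzero_q (tadditive T E).
have h : tzero T E ;; K ;; dlift D = tzero T E ;; K ;; tzero T E.
  by rewrite -compA (vc_linear_p hK) compA tzero_l -compA -fmapM /tzero tzero_nat.
have := congr1 (fun f => f ;; tp T E) h.
rewrite -!compA zp compm1 (abm_q (dlift_p D)) !compA.
by rewrite -(compA _ K) (vc_q hK) compA zp comp1m.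
Qed.

Lemma dmu_is_sum :
  is_sum (fadd T qadd) (bpi0 D ;; dlift D) (bpi1 D ;; tzero T E) (dmu D).
Proof. exact: (badd_is_sum (map_bundle (dpreserved D))). Qed.

Lemma dvert_is_sum :
  is_sum (fadd T qadd) (K ;; dlift D) (tp T E ;; tzero T E) v.
Proof.
have := is_sum_pre (bpair D (vc_q hK)) dmu_is_sum.
rewrite (compA _ (bpi0 D)) (compA _ (bpi1 D)).
by rewrite (pb_lift0 (b2_pullback D)) (pb_lift1 (b2_pullback D)).
Qed.

Lemma dmu_Tq : dmu D ;; fmap T q = bpi0 D ;; q ;; tzero T M.
Proof. by rewrite (pb_comm (duniversal D 0)). Qed.

Lemma dvert_Tq : v ;; fmap T q = tp T E ;; q ;; tzero T M.
Proof.
by rewrite /v /dvert -compA dmu_Tq !compA (pb_lift0 (b2_pullback D)) (vc_q hK).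
Qed.

(** v is the T(q)-sum of K lambda and p 0, which K sends to K and to zero. *)
Lemma dvert_K : v ;; K = K.
Proof.
have := is_sum_image vconn_preserves_bundle_sums dvert_is_sum.
rewrite -!compA (vc_retract hK) compm1 vconn_zero compA -(vc_q hK) => h.
exact: bundle_sum_uniq h (is_sum0 (dadditive D) K).
Qed.

Lemma fadd2_uniq : single_valued (fadd T (fadd T qadd)).
Proof. exact: (single_valued_pullback (wp2_pullback (dpreserved D 2 2)
  : is_pullback _ _ (add_l (fadd T (fadd T qadd))) _)). Qed.

(** Both sides are T^2(q)-sums of the same two terms, by the linearity of K
for p_E; the next lemma is the analogue for T(q). *)
Lemma dvert_l : v ;; tl T E = tl T E ;; fmap T v.
Proof.
have hl := is_sum_image (tl_preserves_fadd T qadd) dvert_is_sum.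
have hr := is_sum_pre (tl T E) (is_sum_fmap T dvert_is_sum).
apply: fadd2_uniq hl _; move: hr; rewrite !fmapM !compA.
by rewrite -(vc_linear_p hK) tl_p -!compA dlift_l tzero_l.
Qed.

Lemma dvert_Tlift_c :
  v ;; (fmap T (dlift D) ;; tc T E) = fmap T (dlift D) ;; tc T E ;; fmap T v.
Proof.
have hq := abm_preserves_sums (dlift_T D).
have hl := is_sum_image (preserves_sums_comp
  (preserves_sums_fmap T hq) (tc_preserves_fadd T qadd)) dvert_is_sum.
have hr := is_sum_pre (fmap T (dlift D) ;; tc T E) (is_sum_fmap T dvert_is_sum).
apply: fadd2_uniq hl _; move: hr; rewrite !fmapM !compA.
rewrite -(vc_linear_T hK) -(compA _ (tc T E)) tc_p tp_nat.
rewrite -!compA (compA (dlift D) _ (tc T E)) -dlift_l -compA tlc.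
by rewrite (compA (tzero T E)) tzero_nat -(compA (dlift D)) tzero_c.
Qed.

(** The vertical vectors w, those that T(q) sends to zero, are the image of
mu; applying K to w = <a, b> mu gives a = w K, and p gives b = w p. *)
Lemma vertical_is_sum (Z : X) (w : Z ~> T E) :
  w ;; fmap T q = w ;; tp T E ;; q ;; tzero T M ->
  is_sum (fadd T qadd) (w ;; K ;; dlift D) (w ;; tp T E ;; tzero T E) w.
Proof.
move=> hw; pose P := duniversal D 0; pose u : Z ~> b2 D := pb_lift P hw.
have uE : u ;; dmu D = w := pb_lift0 P hw.
have u1 : u ;; bpi1 D = w ;; tp T E by rewrite -uE -compA dmu_p.
have := is_sum_pre u dmu_is_sum.
rewrite uE (compA u (bpi0 D)) (compA u (bpi1 D)) u1 => h.
have u0 : u ;; bpi0 D = w ;; K.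
  have := is_sum_image vconn_preserves_bundle_sums h.
  rewrite -!compA (vc_retract hK) compm1 vconn_zero !compA -u1.
  rewrite -(compA u (bpi1 D)) -(pb_comm (b2_pullback D)) compA.
  exact: (bundle_sum_uniq (is_sum0 (dadditive D) _)).
by rewrite u0 in h.
Qed.

Variable n : negatives T.

Let d : T E ~> T E := tsub n (dvert_sub_over D (vc_q hK)).

Lemma horpart_is_sum : is_sum (padd E) d v (idm (T E)).
Proof. exact: tsub_is_sum. Qed.

(** The map K, being additive, carries the negative of z to a negative of
z K, so elements of this form can be cancelled in q. *)
Lemma vconn_image_cancel (Z : X) (x y : Z ~> E) (z : Z ~> T E) (s : Z ~> E) :
  is_sum qadd x (z ;; K) s -> is_sum qadd y (z ;; K) s -> x = y.
Proof.
apply: (is_sum_cancel (dadditive D) (z' := z ;; n E ;; K)).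
have := is_sum_image vconn_preserves_tangent_sums (neg_is_sum n z).
rewrite -[bzero _]/(tzero T E) -(compA _ (tzero T E)) vconn_zero !compA.
by rewrite -(compA z (tp T E)) -(vc_q hK) !compA.
Qed.

(** The difference w = x - y is vertical with the same K and p as the zero
vector z at the same point, hence is that zero vector. *)
Lemma Tq_p_K_jointly_monic (Z : X) (x y : Z ~> T E) :
  x ;; fmap T q = y ;; fmap T q -> x ;; tp T E = y ;; tp T E ->
  x ;; K = y ;; K -> x = y.
Proof.
move=> eq ep eK.
have hw := tsub_is_sum n ep; set w := tsub n ep in hw.
have wp : w ;; tp T E = x ;; tp T E by rewrite (is_sum_over hw).
pose z := x ;; tp T E ;; tzero T E.
have zp : z ;; tp T E = x ;; tp T E.
  by rewrite -compA [tzero T E ;; _](bzero_q (tadditive T E)) compm1.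
have zq : z ;; fmap T q = x ;; tp T E ;; q ;; tzero T M.
  by rewrite -!compA /tzero tzero_nat.
have wq : w ;; fmap T q = x ;; tp T E ;; q ;; tzero T M.
  have h1 := is_sum_image (fmap_preserves_sums T q) hw.
  have h2 := is_sumC (tadditive T M) (is_sum0 (tadditive T M) (y ;; fmap T q)).
  rewrite eq in h1; rewrite (tangent_cancel n h1 h2) -eq -(compA x) tp_nat.
  by rewrite !compA.
have wK : w ;; K = z ;; K.
  have h1 := is_sum_image vconn_preserves_tangent_sums hw.
  have h2 := is_sumC (dadditive D) (is_sum0 (dadditive D) (y ;; K)).
  rewrite eK in h1; rewrite (vconn_image_cancel h1 h2) -eK -(compA x K).
  by rewrite (vc_q hK) /z -[RHS]compA vconn_zero !compA.
have wz : w = z.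
  have := vertical_is_sum (w := w); rewrite wq wp wK => /(_ erefl) h1.
  have := vertical_is_sum (w := z); rewrite zq zp => /(_ erefl) h2.
  exact: (bundle_sum_uniq (A := map_bundle (dpreserved D)) h1 h2).
rewrite wz /z ep in hw.
exact: bundle_sum_uniq hw
  (is_sumC (tadditive T E) (is_sum0 (tadditive T E) y)).
Qed.

Lemma horpart_p : d ;; tp T E = tp T E.
Proof. by rewrite (is_sum_over horpart_is_sum) dvert_p. Qed.

Lemma horpart_Tq : d ;; fmap T q = fmap T q.
Proof.
have h := is_sum_image (fmap_preserves_sums T q) horpart_is_sum.
rewrite comp1m dvert_Tq -tp_nat in h.
have hb := is_sum_base (tadditive T M) h; rewrite hb in h.
exact: bundle_sum_uniq (is_sum0 (tadditive T M) _) h.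
Qed.

Lemma horpart_K : d ;; K = tp T E ;; q ;; bzero D.
Proof.
have h := is_sum_image vconn_preserves_tangent_sums horpart_is_sum.
rewrite comp1m dvert_K -{2}[K]comp1m in h.
apply: (vconn_image_cancel h); rewrite comp1m -(vc_q hK).
exact: (is_sumC (dadditive D) (is_sum0 (dadditive D) K)).
Qed.

(** Adding v f to d f or to g T(d) c gives f, so these two maps agree by
cancellation; then c is removed, being an involution.  Composing with c moves
the second sum from T(p) to p, where negatives are at hand. *)
Lemma horpart_commute (f g : T E ~> T (T E)) :
  preserves_sums (padd E) (padd (T E)) f -> g ;; tc T E = f ->
  v ;; g = g ;; fmap T v -> d ;; g = g ;; fmap T d.
Proof.
move=> hf gf vg.
have hd := is_sum_image hf horpart_is_sum.
have hc := is_sum_pre g (is_sum_image (tc_preserves_sums T E)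
                            (is_sum_fmap T horpart_is_sum)).
rewrite fmap1 comp1m !compA -vg -(compA v) !gf in hc.
rewrite comp1m in hd.
have /(congr1 (fun h => h ;; tc T E)) := tangent_cancel n hd hc.
by rewrite -gf -(compA d) -!(compA _ (tc T E)) tcc !compm1.
Qed.

Lemma horpart_l : d ;; tl T E = tl T E ;; fmap T d.
Proof.
exact: horpart_commute (tl_preserves_sums T E) (tlc T E) dvert_l.
Qed.

Lemma horpart_Tlift_c :
  d ;; (fmap T (dlift D) ;; tc T E) = fmap T (dlift D) ;; tc T E ;; fmap T d.
Proof.
apply: horpart_commute (fmap_preserves_sums T (dlift D)) _ dvert_Tlift_c.
by rewrite -compA tcc compm1.
Qed.

End VerticalConnection.

(** * The connection *)

(** The four equations of a horizontal connection are each transported along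
an endomorphism of T(E) that is linear for both bundle structures on T(E) and
lies over the identity in both directions. *)
Lemma horizontal_connection_comp (X : category) (T : tangent_structure X)
    (E M : X) (q : E ~> M) (D : differential_bundle T q)
    (J : dhor D ~> T E) (d : T E ~> T E) :
  d ;; fmap T q = fmap T q -> d ;; tp T E = tp T E ->
  d ;; tl T E = tl T E ;; fmap T d ->
  d ;; (fmap T (dlift D) ;; tc T E) = fmap T (dlift D) ;; tc T E ;; fmap T d ->
  horizontal_connection D J -> horizontal_connection D (J ;; d).
Proof.
move=> dq dp dl dc hJ; split.
- by rewrite -compA dq (hc_Tq hJ).
- by rewrite -compA dp (hc_p hJ).
- by rewrite -compA dl compA (hc_linear_p hJ) fmapM compA.
- by rewrite -!compA dc !compA (hc_linear_T hJ) fmapM compA.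
Qed.

Theorem proposition5p13 (X : category) (T : tangent_structure X)
    (n : negatives T) (E M : X) (q : E ~> M) (D : differential_bundle T q)
    (K : T E ~> E) (hK : vertical_connection D K)
    (J : dhor D ~> T E) (hJ : horizontal_connection D J) :
  let H := J ;; tsub n (dvert_sub_over D (vc_q hK)) in
  horizontal_connection D H /\ connection D K H.
Proof.
move=> H.
have hH : horizontal_connection D H.
  exact: horizontal_connection_comp (horpart_Tq hK n) (horpart_p hK n)
    (horpart_l hK n) (horpart_Tlift_c hK n) hJ.
have HK : H ;; K = dpi1 D ;; q ;; bzero D.
  by rewrite /H -compA horpart_K !compA (hc_p hJ).
split=> //; apply: (Connection (cn_vertical := hK) (cn_horizontal := hH)) => //.
set e := dU_hor_over _ _.
have hs := badd_is_sum (tbundle T E) e; set s := badd _ e in hs *.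
apply: (Tq_p_K_jointly_monic hK n); rewrite comp1m.
- have := is_sum_image (fmap_preserves_sums T q) hs.
  rewrite dvert_Tq -(compA _ H) (hc_Tq hH).
  rewrite (pb_lift0 (dhor_pullback D 0)) -tp_nat => h.
  by apply: (bundle_sum_uniq h); apply/is_sumC/is_sum0; apply: tadditive.
- by rewrite (is_sum_base (tadditive T E) hs) dvert_p.
- have := is_sum_image (vconn_preserves_tangent_sums hK) hs.
  rewrite dvert_K -(compA _ H) HK.
  rewrite (compA _ _ (bzero D)) (compA (dU D) (dpi1 D)).
  rewrite (pb_lift1 (dhor_pullback D 0)) -(vc_q hK) => h.
  exact: (bundle_sum_uniq h (is_sum0 (dadditive D) K)).
Qed.
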